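(* A simplicial complex $\Gamma$ is the illegal complex $\Gamma_{R,B}$ of some invariant strong placement game (iSP-game) $(R,B)$ if and only if $\Gamma$ has no isolated vertices.
   Context: A board is a finite graph. A ruleset $R$ specifies which pieces each of the two players, Left and Right, may place (each piece occupies a non-empty collection of vertices of the board) and which placements are legal; $(R,B)$ denotes the game with ruleset $R$ played on board $B$. A position is a configuration of pieces on the board. A basic position is the board with exactly one piece placed. A position is legal if it can be reached from the empty board by a sequence of legal moves, and illegal otherwise. A strong placement game (SP-game) is a combinatorial game (two players, perfect information, no chance, no simultaneous moves) such that: (i) the board is empty at the beginning; (ii) players place pieces on empty spaces of the board according to the rules; (iii) pieces are not moved or removed once placed; (iv) if a position can be reached through a sequence of legal moves, then any sequence of moves leading to this position consists of legal moves. Hence a position is identified with the set of basic positions it is made of, and every subset of a legal position is legal. The illegal complex $\Gamma_{R,B}$ is the simplicial complex on the set of basic positions whose facets are the minimal illegal positions (illegal positions all of whose proper subsets are legal); it is the empty complex if there are no illegal positions (the empty complex is not distinguished from $\{\emptyset\}$). An isolated vertex of a simplicial complex is a vertex $v$ such that $\{v\}$ is a facet. A board isomorphism between two boards (possibly already containing pieces) is a graph isomorphism such that a vertex contains a Left (respectively Right) piece if and only if its image does. The ruleset of an SP-game is invariant if: every basic position is legal; and the ruleset does not depend on the board, i.e. for any board isomorphism between boards $B_1$ and $B_2$, a move in $B_1$ is legal if and only if its isomorphic image in $B_2$ is legal. An SP-game with invariant ruleset is an invariant strong placement game (iSP-game). *)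

(* Defs.v *)
From mathcomp Require Import all_boot.

Set Implicit Arguments.
Unset Strict Implicit.
Unset Printing Implicit Defensive.

(* The empty complex is not distinguished from {set0}; both are represented by
   {set0}.  A point v of T with [set v] not a face is not a vertex. *)
Record complex (T : finType) := Complex {
  faces : {set {set T}};
  faces0 : set0 \in faces;
  faces_sub : forall F G : {set T}, F \in faces -> G \subset F -> G \in faces
}.

Definition vertices (T : finType) (K : complex T) : {set T} :=
  [set v | [set v] \in faces K].

Definition facet (T : finType) (K : complex T) (F : {set T}) : bool :=
  maxset [pred G : {set T} | G \in faces K] F.

Definition isolated_vertex (T : finType) (K : complex T) (v : T) : bool :=
  facet K [set v].

(* Only vertices are matched: points of the ground types that lie in no face
   play no role. *)
Definition complex_iso (T U : finType) (K : complex T) (L : complex U) : Prop :=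
  exists2 f : {v : T | v \in vertices K} -> {w : U | w \in vertices L},
    bijective f &
    forall F : {set {v : T | v \in vertices K}},
      ([set val v | v in F] \in faces K) = ([set val (f v) | v in F] \in faces L).

Record board := Board {
  cell :> finType;
  adj : rel cell;
  adj_sym : symmetric adj;
  adj_irr : irreflexive adj
}.

Inductive player := Left | Right.

(* A basic position is a piece together with the cells it occupies
   ([basic_inj]).  [legal_move B P x] says whether, with the pieces of P on the
   board B, the piece of x may be placed on the cells of x. *)
Record ruleset := Ruleset {
  piece : Type;
  owner : piece -> player;
  basic : board -> finType;
  piece_of : forall B : board, basic B -> piece;
  cells : forall B : board, basic B -> {set B};
  cells_neq0 : forall (B : board) (x : basic B), cells x != set0;
  basic_inj : forall (B : board) (x y : basic B),
    piece_of x = piece_of y -> cells x = cells y -> x = y;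
  legal_move : forall B : board, {set basic B} -> basic B -> bool
}.

(* Positions are arbitrary sets of basic positions: two pieces sharing a cell
   also make up a position, which is illegal in an SP-game. *)
Definition position (R : ruleset) (B : board) := {set basic R B}.

Definition is_move (R : ruleset) (B : board) : rel (position R B) :=
  fun P Q => [exists x, legal_move P x && (Q == x |: P)].

Definition legal (R : ruleset) (B : board) (P : position R B) : bool :=
  connect (@is_move R B) set0 P.

Fixpoint legal_moves (R : ruleset) (B : board) (P : position R B)
    (s : seq (basic R B)) : bool :=
  if s is x :: s' then legal_move P x && legal_moves (x |: P) s' else true.

(* Conditions (i) and (iii) are built into [legal]: play starts from set0 and
   every move adds one basic position.  Players need not alternate. *)
Definition sp_game (R : ruleset) (B : board) : Prop :=
  (forall (P : position R B) (x y : basic R B),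
     legal_move P x -> y \in P -> [disjoint cells x & cells y]) /\
  (forall s : seq (basic R B),
     uniq s -> legal [set x in s] -> legal_moves set0 s).

Definition minimal_illegal (R : ruleset) (B : board) (P : position R B) : bool :=
  minset [pred Q : position R B | ~~ legal Q] P.

Definition illegal_faces (R : ruleset) (B : board) : {set position R B} :=
  [set F | (F == set0) ||
           [exists P : position R B, minimal_illegal P && (F \subset P)]].

Lemma illegal_faces0 (R : ruleset) (B : board) : set0 \in illegal_faces R B.
Proof. by rewrite inE eqxx. Qed.

Lemma illegal_faces_sub (R : ruleset) (B : board) (F G : position R B) :
  F \in illegal_faces R B -> G \subset F -> G \in illegal_faces R B.
Proof.
rewrite !inE => /orP[/eqP-> | /existsP[P /andP[minP sFP]]] sGF.
  by rewrite -subset0 sGF.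
by apply/orP; right; apply/existsP; exists P; rewrite minP (subset_trans sGF).
Qed.

Definition illegal_complex (R : ruleset) (B : board) : complex (basic R B) :=
  Complex (illegal_faces0 R B) (@illegal_faces_sub R B).

Definition occupies (R : ruleset) (B : board) (P : position R B) (p : player)
    (u : B) : Prop :=
  exists x, [/\ x \in P, owner (piece_of x) = p & u \in cells x].

Definition board_iso (R : ruleset) (B1 B2 : board)
    (P1 : position R B1) (P2 : position R B2) (f : B1 -> B2) : Prop :=
  [/\ bijective f,
      forall u v : B1, adj (f u) (f v) = adj u v &
      forall (p : player) (u : B1), occupies P1 p u <-> occupies P2 p (f u)].

Definition is_image (R : ruleset) (B1 B2 : board) (f : B1 -> B2)
    (x1 : basic R B1) (x2 : basic R B2) : Prop :=
  piece_of x2 = piece_of x1 /\ cells x2 = f @: cells x1.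

(* The image of a move need not be a basic position of B2 a priori; a legal
   move is required to have one.  Moves of B2 are covered by the inverse
   isomorphism. *)
Definition invariant_ruleset (R : ruleset) : Prop :=
  (forall (B : board) (x : basic R B), legal [set x]) /\
  (forall (B1 B2 : board) (P1 : position R B1) (P2 : position R B2)
          (f : B1 -> B2),
     board_iso P1 P2 f ->
     forall x1 : basic R B1,
       legal_move P1 x1 <->
       exists2 x2 : basic R B2, is_image f x1 x2 & legal_move P2 x2).

Definition isp_game (R : ruleset) (B : board) : Prop :=
  sp_game R B /\ invariant_ruleset R.

(* Main.v *)
Require Import Defs.
From mathcomp Require Import all_boot.

(** Every basic position of an iSP-game is legal, so minimal illegal positions
    have at least two elements and the illegal complex has no isolated vertex.
    Conversely, number the points of V and let the basic position v on a board
    occupy all cells of degree [enum_rank v], provided there are some.  Graph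
    isomorphisms preserve degrees, so the occupied cells determine, invariantly,
    which points of V have been played, and one may forbid exactly the sets
    containing a nonempty facet of Gamma.  Singletons stay legal because Gamma
    has no isolated vertex.  Playing on a board that has a cell of degree
    [enum_rank v] for every v then yields Gamma. *)

Set Implicit Arguments.
Unset Strict Implicit.
Unset Printing Implicit Defensive.

(** * Isolated vertices and illegal complexes *)

Lemma minimal_illegal_face (R : ruleset) (B : board) (P : position R B) :
  minimal_illegal P -> P \in faces (illegal_complex R B).
Proof.
by move=> minP; rewrite inE; apply/orP; right; apply/existsP; exists P; rewrite minP /=.
Qed.

(** If [[set x]] were a facet, it would lie in a minimal illegal position, itself a face, and so
    equal it by maximality; but singletons are legal. *)
Lemma illegal_complex_no_isolated (R : ruleset) (B : board) (x : basic R B) :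
  (forall y : basic R B, legal [set y]) ->
  ~~ isolated_vertex (illegal_complex R B) x.
Proof.
move=> legal1; apply/negP => /maxsetP[/= xK maxx].
move: xK; rewrite !inE -cards_eq0 cards1 /= => /existsP[P /andP[minP sxP]].
have := maxx P (minimal_illegal_face minP) sxP => PE.
by case/minsetP: minP => /=; rewrite PE legal1.
Qed.

(** * Isomorphisms of complexes *)

Lemma faces_vertices (T : finType) (K : complex T) (F : {set T}) :
  F \in faces K -> F \subset vertices K.
Proof.
by move=> FK; apply/subsetP => v vF; rewrite inE (faces_sub FK) ?sub1set.
Qed.

(** [complex_iso] speaks only of images under [f]; this makes every face of the target such an
    image, so it can be pulled back. *)
Lemma image_val_preim (T : finType) (A : {set T}) (I : finType)
    (f : I -> {w : T | w \in A}) (F : {set T}) :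
  bijective f -> F \subset A -> [set val (f v) | v in [set v | val (f v) \in F]] = F.
Proof.
case=> g _ gK /subsetP sFA; apply/setP => w; apply/imsetP/idP => [[v]|wF].
  by rewrite inE => vF ->.
by exists (g (exist _ w (sFA w wF))); rewrite ?inE gK.
Qed.

Lemma complex_iso_isolated (T U : finType) (K : complex T) (L : complex U) (v : T) :
  complex_iso K L -> isolated_vertex K v -> exists w, isolated_vertex L w.
Proof.
case=> f bij_f facesE /maxsetP[/= vK maxv].
have vV : v \in vertices K by rewrite inE.
pose v' : {v : T | v \in vertices K} := exist _ v vV.
exists (val (f v')); apply/maxsetP; split=> /= [|F FL swF].
  by have := facesE [set v']; rewrite !imset_set1 vK => <-.
(* The preimage of [F] is a face containing [v], so maximality of [[set v]] shrinks it to one point,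
   and [F] with it. *)
pose F' := [set u | val (f u) \in F].
have imF' : [set val (f u) | u in F'] = F by rewrite image_val_preim ?faces_vertices.
have v'F' : v' \in F' by rewrite inE -sub1set.
have /maxv : [set val u | u in F'] \in faces K by rewrite facesE imF'.
rewrite sub1set => /(_ (imset_f val v'F')) F'E.
suff F'1 : F' = [set v'] by rewrite -imF' F'1 imset_set1.
by apply: (imset_inj val_inj); rewrite F'E imset_set1.
Qed.

Lemma complex_iso_bij (T U : finType) (K : complex T) (L : complex U) (g : T -> U) :
  bijective g -> (forall F : {set T}, (g @: F \in faces L) = (F \in faces K)) ->
  complex_iso K L.
Proof.
move=> [h gK hK] gF.
have gV v : (g v \in vertices L) = (v \in vertices K).
  by rewrite !inE -gF imset_set1.
have gV1 (v : {v | v \in vertices K}) : g (val v) \in vertices L.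
  by rewrite gV (valP v).
have hV1 (w : {w | w \in vertices L}) : h (val w) \in vertices K.
  by rewrite -gV hK (valP w).
exists (fun v => exist _ (g (val v)) (gV1 v)) => [|F].
  exists (fun w => exist _ (h (val w)) (hV1 w)) => u; apply: val_inj => /=.
    exact: gK.
  exact: hK.
by rewrite -gF -imset_comp.
Qed.

(** * The degree game *)

Section DegreeGame.

Variables (V : finType) (Gamma : complex V).

Definition degree (B : board) (u : B) : nat := #|[set w | adj u w]|.

Lemma degree_iso (B1 B2 : board) (f : B1 -> B2) (u : B1) :
  bijective f -> (forall u v, adj (f u) (f v) = adj u v) ->
  degree (f u) = degree u.
Proof.
move=> bij_f adjf; rewrite /degree -(card_imset _ (bij_inj bij_f)).
have [g _ gK] := bij_f; apply: eq_card => w; rewrite inE.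
apply/idP/imsetP => [uw|[w']]; last by rewrite inE => uw' ->; rewrite adjf.
by exists (g w); rewrite ?inE -?adjf gK.
Qed.

Definition degree_cells (B : board) (v : V) : {set B} :=
  [set u | degree u == enum_rank v :> nat].

Lemma degree_cells_inj (B : board) (u : B) (v w : V) :
  u \in degree_cells B v -> u \in degree_cells B w -> v = w.
Proof.
rewrite !inE => /eqP-> /eqP vw; apply: enum_rank_inj; exact: val_inj.
Qed.

Lemma degree_cells_iso (B1 B2 : board) (f : B1 -> B2) (v : V) :
  bijective f -> (forall u v, adj (f u) (f v) = adj u v) ->
  f @: degree_cells B1 v = degree_cells B2 v.
Proof.
move=> bij_f adjf; have [g _ gK] := bij_f.
apply/setP => w; apply/imsetP/idP => [[u]|]; rewrite inE.
  by move=> degu ->; rewrite inE degree_iso.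
by move=> degw; exists (g w); rewrite ?gK // inE -(degree_iso (g w) bij_f adjf) gK.
Qed.

(** If [set0] is the only face, it is a facet; without [F != set0] even the empty board would then
    be forbidden. *)
Definition forbidden (S : {set V}) : bool :=
  [exists F : {set V}, [&& facet Gamma F, F != set0 & F \subset S]].

Lemma forbidden_sub (S S' : {set V}) : S \subset S' -> forbidden S -> forbidden S'.
Proof.
move=> sSS' /existsP[F /and3P[FG F0 sFS]]; apply/existsP; exists F.
by rewrite FG F0 (subset_trans sFS).
Qed.

Lemma forbidden0 : ~~ forbidden set0.
Proof. by apply/existsP => -[F /and3P[_ F0]]; rewrite subset0 (negPf F0). Qed.

Lemma forbidden1 (v : V) : ~~ isolated_vertex Gamma v -> ~~ forbidden [set v].
Proof.
move=> niso; apply/existsP => -[F /and3P[FG F0]].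
rewrite subset1 (negPf F0) orbF => /eqP FE.
by move: niso; rewrite /isolated_vertex -FE FG.
Qed.

Definition degree_basic (B : board) : finType :=
  {v : V | degree_cells B v != set0}.

Lemma degree_basic_inj (B : board) (x y : degree_basic B) :
  degree_cells B (val x) = degree_cells B (val y) -> x = y.
Proof.
move=> Cxy; apply: val_inj.
have /set0Pn[u ux] := valP x.
by apply: (degree_cells_inj ux); rewrite -Cxy.
Qed.

(** One kind of piece suffices, since the cells already identify the basic position. Reading
    positions in [V] through [val] makes the test comparable across boards, and the [\notin] test
    keeps pieces disjoint because degree classes are. *)
Definition degree_ruleset : ruleset :=
  @Ruleset unit (fun _ => Left) degree_basic (fun _ _ => tt)
    (fun B x => degree_cells B (val x)) (fun B x => valP x)
    (fun B x y _ => @degree_basic_inj B x y)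
    (fun B P x => (val x \notin val @: P) && ~~ forbidden (val x |: val @: P)).

(** Every intermediate position is contained in the final one, and [forbidden] is monotone, so the
    order of play is irrelevant. *)
Lemma degree_legal_moves (B : board) (P : position degree_ruleset B) s :
  uniq s -> {in s, forall x, x \notin P} ->
  ~~ forbidden (val @: (P :|: [set x in s])) -> legal_moves P s.
Proof.
elim: s P => //= x s IHs P /andP[xs us] sP nforb.
have xP := sP x (mem_head _ _).
have PsE : (x |: P) :|: [set y in s] = P :|: [set y in x :: s].
  by rewrite set_cons setUCA setUA.
rewrite mem_imset ?xP /=; last exact: val_inj.
apply/andP; split.
  apply: contra nforb; apply: forbidden_sub.
  by rewrite -imsetU1 imsetS // -PsE subsetUl.
apply: IHs; rewrite ?PsE // => y ys; rewrite !inE negb_or sP ?inE ?ys ?orbT // andbT.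
by apply: contraNneq xs => <-.
Qed.

Lemma legal_moves_connect (R : ruleset) (B : board) (P : position R B) s :
  legal_moves P s -> connect (@is_move R B) P (P :|: [set x in s]).
Proof.
elim: s P => [|x s IHs] P /=; first by rewrite set_nil setU0 connect0.
case/andP => Px /IHs; rewrite set_cons setUCA setUA; apply: connect_trans.
by apply: connect1; apply/existsP; exists x; rewrite Px eqxx.
Qed.

(** The last move tests the whole resulting position; conversely, an allowed position can be played
    in the order of [enum P]. *)
Lemma degree_legalE (B : board) (P : position degree_ruleset B) :
  legal P = ~~ forbidden (val @: P).
Proof.
apply/idP/idP => [|nforb].
  case/connectP=> p; elim/last_ind: p => [_ ->|p Q _].
    by rewrite imset0 forbidden0.
  rewrite rcons_path last_rcons => /andP[_ /existsP[x /andP[/andP[_ nforb] /eqP QE]]].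
  by move=> ->; rewrite QE imsetU1.
have := @legal_moves_connect degree_ruleset B set0 (enum P).
by rewrite set0U set_enum; apply; apply: degree_legal_moves => [|x|];
  rewrite ?enum_uniq ?inE // set0U set_enum.
Qed.

Lemma degree_sp_game (B : board) : sp_game degree_ruleset B.
Proof.
split=> [P x y /andP[xP _] yP | s us].
  rewrite -setI_eq0; apply: contraNT xP => /set0Pn[u /setIP[ux uy]].
  by rewrite (degree_cells_inj ux uy) imset_f.
rewrite degree_legalE => nforb.
by apply: degree_legal_moves; rewrite ?set0U // => x; rewrite inE.
Qed.

(** The classes are disjoint, and those played are nonempty, so one occupied cell reveals its point.
    Thus [val @: P] depends only on data preserved by [board_iso]. *)
Lemma occupies_degree (B : board) (P : position degree_ruleset B) (v : V) :
  v \in val @: P <-> exists2 u, occupies P Left u & u \in degree_cells B v.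
Proof.
split=> [/imsetP[x xP ->]|[u [x [xP _ ux]] uv]].
  by have /set0Pn[u ux] := valP x; exists u => //; exists x.
by rewrite (degree_cells_inj uv ux) imset_f.
Qed.

Lemma board_iso_val (B1 B2 : board) (P1 : position degree_ruleset B1)
    (P2 : position degree_ruleset B2) (f : B1 -> B2) :
  board_iso P1 P2 f -> val @: P1 = val @: P2.
Proof.
case=> bij_f adjf occf; have cellsE v := degree_cells_iso v bij_f adjf.
apply/setP => v; apply/idP/idP => /occupies_degree[u Pu uv]; apply/occupies_degree.
  by exists (f u); [apply/occf | rewrite -cellsE imset_f].
move: uv Pu; rewrite -cellsE => /imsetP[w wv ->] /occf Pw.
by exists w.
Qed.

Lemma degree_invariant :
  (forall v, ~~ isolated_vertex Gamma v) -> invariant_ruleset degree_ruleset.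
Proof.
move=> niso; split=> [B x | B1 B2 P1 P2 f isof x1].
  by rewrite degree_legalE imset_set1 forbidden1.
have P12 := board_iso_val isof; case: isof => bij_f adjf _.
have cellsE := degree_cells_iso (val x1) bij_f adjf.
rewrite /legal_move /= P12; split=> [moveP|[x2 [_ x2E]]].
  (* The isomorphism carries the nonempty class of [val x1] onto its class in [B2], so the same
     point is playable there. *)
  have x2_ne0 : degree_cells B2 (val x1) != set0.
    by rewrite -cellsE imset_eq0 (valP x1).
  by exists (exist _ (val x1) x2_ne0) => //; split=> /=.
have /set0Pn[u ux] := valP x2.
suff -> : val x2 = val x1 by [].
by apply: (degree_cells_inj ux); rewrite -cellsE -[f @: _]x2E.
Qed.

(** * The half graph as a board *)

Definition half_adj : rel (V + V) := fun a b =>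
  match a, b with
  | inl v, inr w => enum_rank w < enum_rank v
  | inr w, inl v => enum_rank w < enum_rank v
  | _, _ => false
  end.

Lemma half_adj_sym : symmetric half_adj.
Proof. by case=> v [] w. Qed.

Lemma half_adj_irr : irreflexive half_adj.
Proof. by case. Qed.

(* The left cells of the half graph have pairwise distinct degrees, while the
   right cells only enlarge some degree classes. *)
Definition half_board : board := Board half_adj_sym half_adj_irr.

Lemma degree_half_board (v : V) : inl v \in degree_cells half_board v.
Proof.
rewrite inE /degree; apply/eqP.
have -> : [set w : half_board | adj (inl v : half_board) w] =
    (fun i : 'I_#|V| => inr (enum_val i)) @: [set i : 'I_#|V| | i < enum_rank v].
  apply/setP => -[w|w]; rewrite inE /=.
    by apply/esym/imsetP => -[].
  apply/idP/imsetP => [wv|[i]].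
    by exists (enum_rank w); rewrite ?inE ?enum_rankK.
  by rewrite inE => iv [->]; rewrite enum_valK.
rewrite card_imset => [|i j [/enum_val_inj]] //.
rewrite cardsE -sum1_card.
(* The neighbours are now counted by a sum of ones over the ordinals below [enum_rank v], which is
   at most [#|V|]. *)
have /(big_ord_widen _ (fun=> 1)) := ltnW (ltn_ord (enum_rank v)) => /= <-.
by rewrite sum1_card card_ord.
Qed.

Lemma half_board_basic (v : V) : degree_cells half_board v != set0.
Proof. by apply/set0Pn; exists (inl v); apply: degree_half_board. Qed.

Definition half_pos (v : V) : basic degree_ruleset half_board :=
  exist _ v (half_board_basic v).

Lemma half_pos_bij : bijective half_pos.
Proof. by exists val => // x; apply: val_inj. Qed.

Lemma val_half_pos (S : {set V}) : val @: (half_pos @: S) = S.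
Proof. by rewrite -imset_comp imset_id. Qed.

Lemma half_pos_legal (S : {set V}) : legal (half_pos @: S) = ~~ forbidden S.
Proof. by rewrite degree_legalE val_half_pos. Qed.

(** Illegal sets are the supersets of nonempty facets. As facets form an antichain, the minimal
    illegal sets are exactly the nonempty facets. *)
Lemma half_pos_minimal_illegal (S : {set V}) :
  minimal_illegal (half_pos @: S) = facet Gamma S && (S != set0).
Proof.
have half_inj := bij_inj half_pos_bij.
apply/minsetP/andP => /= [[] | [SG S0]]; rewrite half_pos_legal negbK.
  case/existsP=> F /and3P[FG F0 sFS] minS.
  suff <- : F = S by [].
  apply: (imset_inj half_inj); apply: minS; last exact: imsetS.
  by rewrite half_pos_legal negbK; apply/existsP; exists F; rewrite FG F0 /=.
split=> [|P]; first by apply/existsP; exists S; rewrite SG S0 /=.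
rewrite degree_legalE negbK => /existsP[F /and3P[FG _ sFP]] sPS.
have sPS' : val @: P \subset S by rewrite -[S]val_half_pos imsetS.
have SF : S = F.
  have /maxsetP[_ maxF] := FG; apply: maxF; last exact: subset_trans sPS'.
  exact: maxsetp SG.
apply/eqP; rewrite eqEsubset sPS /=.
apply/subsetP => _ /imsetP[v vS ->]; move: vS; rewrite SF => /(subsetP sFP).
by case/imsetP=> x xP ->; suff -> : half_pos (val x) = x by []; apply: val_inj.
Qed.

Lemma half_board_illegal_complex :
  complex_iso Gamma (illegal_complex degree_ruleset half_board).
Proof.
apply: (complex_iso_bij half_pos_bij) => F; rewrite inE imset_eq0.
apply/orP/idP => [[/eqP->|/existsP[P]]|FG]; first exact: faces0.
  have -> : P = half_pos @: (val @: P).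
    by rewrite -imset_comp -[LHS]imset_id; apply: eq_imset => x; apply: val_inj.
  rewrite half_pos_minimal_illegal => /andP[/andP[/maxsetp PG _]].
  by move/(imsetS val); rewrite !val_half_pos; apply: faces_sub PG.
have [->|F0] := eqVneq F set0; [by left | right].
(* A nonempty face extends to a facet, necessarily nonempty, whose image is a minimal illegal
   position. *)
have [S SG sFS] := @maxset_exists _ [pred G : {set V} | G \in faces Gamma] F FG.
apply/existsP; exists (half_pos @: S).
rewrite half_pos_minimal_illegal imsetS // andbT /facet SG /=.
by apply: contraNneq F0 => S0; rewrite -subset0 -S0.
Qed.

End DegreeGame.

Theorem theorem2p14 (V : finType) (Gamma : complex V) :
  (exists (R : ruleset) (B : board),
     isp_game R B /\ complex_iso Gamma (illegal_complex R B)) <->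
  (forall v : V, ~~ isolated_vertex Gamma v).
Proof.
split=> [[R [B [[_ [legal1 _]] iso]]] v | niso].
  apply/negP => /(complex_iso_isolated iso)[w].
  by apply/negP; apply: illegal_complex_no_isolated => y; apply: legal1.
exists (degree_ruleset Gamma), (half_board V); split; last exact: half_board_illegal_complex.
by split; [apply: degree_sp_game | apply: degree_invariant].
Qed.
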